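(* Let $\gamma_1,\dots,\gamma_K$ and $\delta_1,\dots,\delta_L$ be positive integers. Then the following two statements are equivalent: (i) for every partition $\lambda$, the ratio $$\frac{\prod_{k=1}^{K} H_{\gamma_k}(\lambda)}{\prod_{l=1}^{L} H_{\delta_l}(\lambda)}$$ is an integer; (ii) for every partition $\mu$, $$\sum_{k=1}^{K} h_{\gamma_k}(\mu)-\sum_{l=1}^{L} h_{\delta_l}(\mu)\ \ge\ 0 .$$
   Context: A partition $\lambda=(\lambda_1,\dots,\lambda_d)$ is a weakly decreasing finite sequence of positive integers (possibly empty), identified with its Young diagram. For a box $\square$ of the Young diagram, the hook based at $\square$ is the set of boxes consisting of $\square$ itself, the boxes of the diagram exactly to the right of $\square$ in its row, and the boxes exactly below $\square$ in its column. The hook length $h(\square)$ is the number of boxes in this hook. Let $\mathcal{H}(\lambda)$ denote the multiset of hook lengths of all boxes of $\lambda$. For a positive integer $r$, define the multiset (with repetitions) $\mathcal{H}_r(\lambda)=\{h/r : h\in\mathcal{H}(\lambda),\ r\mid h\}$. Let $H_r(\lambda)$ be the product of the elements of $\mathcal{H}_r(\lambda)$, counted with multiplicity (the empty product is $1$), and let $h_r(\lambda)$ be the cardinality of $\mathcal{H}_r(\lambda)$, counted with multiplicity, i.e. the number of boxes of $\lambda$ whose hook length is divisible by $r$. *)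

(* Defs.v *)
From mathcomp Require Import all_boot.

Set Implicit Arguments.
Unset Strict Implicit.
Unset Printing Implicit Defensive.

Definition is_partition (la : seq nat) : bool := sorted geq la && (0 \notin la).

(* A box is a pair (row, column), both numbered from 0, with rows going
   downwards and columns going to the right. *)
Definition boxes (la : seq nat) : seq (nat * nat) :=
  [seq (i, j) | i <- iota 0 (size la), j <- iota 0 (nth 0 la i)].

(* The right arm (same row) and the leg below (same column); both
   inequalities are weak, and the filter keeps the corner b itself once. *)
Definition hook (la : seq nat) (b : nat * nat) : seq (nat * nat) :=
  [seq c <- boxes la | (c.1 == b.1) && (b.2 <= c.2)
                    || (c.2 == b.2) && (b.1 <= c.1)].

Definition hook_length (la : seq nat) (b : nat * nat) : nat :=
  size (hook la b).

(* Multisets of natural numbers are represented by sequences; only their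
   product and their size, which do not depend on the order, are used. *)
Definition hook_lengths (la : seq nat) : seq nat :=
  [seq hook_length la b | b <- boxes la].

Definition hook_quotients (r : nat) (la : seq nat) : seq nat :=
  [seq h %/ r | h <- hook_lengths la & r %| h].

Definition hook_prod (r : nat) (la : seq nat) : nat :=
  \prod_(h <- hook_quotients r la) h.

Definition hook_count (r : nat) (la : seq nat) : nat :=
  size (hook_quotients r la).

(* Main.v *)
Require Import Defs.
From mathcomp Require Import all_boot all_order all_algebra.
From mathcomp Require Import zify.
Import Order.TTheory GRing.Theory Num.Theory.

Set Implicit Arguments.
Unset Strict Implicit.
Unset Printing Implicit Defensive.

(** The prime factorization of H_r(lambda) is a sum of hook counts: a prime p
    occurs in it with exponent the sum over k >= 1 of h_{r p^k}(lambda)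
    ([logn_hook_prod]).  Both implications follow by comparing these counts with
    hook counts of other partitions, by means of the quotient construction for
    partitions.

    A partition with rows la_0 >= la_1 >= ... >= la_(d-1) is encoded by its set
    X of beads la_i + (d - 1 - i).  The hook lengths of the partition are the
    differences x - y, with x in X and 0 <= y < x a gap, that is y not in X
    ([perm_hook_lengths]), and every finite set of beads is obtained in this way,
    up to rows of length zero ([partition_of_beads]).  The difference x - y is a
    multiple of m exactly when x and y have the same residue modulo m.  Hence X
    falls apart into m runners, one for each residue, and the hook lengths of la
    divisible by m, divided by m, are the hook lengths of the m partitions encoded
    by the runners ([hook_quotient_partitions]).

    If the differences of counts are nonnegative, apply this to m = p^k:
    h_{g p^k}(lambda) is the sum of h_g over the p^k quotient partitions, so that
    the exponent of p in the ratio is a sum of nonnegative differences.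

    Conversely, given mu, take a prime p larger than every hook length of mu, and
    let lambda be encoded by p X, where X encodes mu.  All runners of p X
    but one are empty, hence h_{g p^k}(lambda) = h_{g p^(k-1)}(mu)
    ([partition_scaling_hooks]), which vanishes for k >= 2.  The exponent of p in
    the ratio at lambda is therefore the difference of counts at mu. *)

(** * Hook lengths of a diagram, row by row *)

Lemma count_geq_ltn j s : count (geq j) s + count (ltn j) s = size s.
Proof.
rewrite -(count_predC (geq j)); congr (_ + _).
by apply: eq_count => x /=; rewrite -ltnNge.
Qed.

Lemma boxes_cons a s :
  boxes (a :: s) =
  [seq (0, j) | j <- iota 0 a] ++ [seq (b.1.+1, b.2) | b <- boxes s].
Proof.
rewrite /boxes /= map_allpairs; congr (_ ++ _).
by rewrite -[1]/(1 + 0) iotaDl -map_comp.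
Qed.

(** A hook never reaches a row above its corner, so that removing the first row
    leaves the hooks of the other rows unchanged.  This is what allows induction
    on the list of rows. *)
Lemma hook_length_row_succ a s b :
  hook_length (a :: s) (b.1.+1, b.2) = hook_length s b.
Proof.
rewrite /hook_length /hook !size_filter boxes_cons count_cat !count_map.
rewrite (eq_count (a2 := pred0)) ?count_pred0; last first.
  by move=> j /=; rewrite andbF.
exact: eq_count.
Qed.

Lemma count_column s j : count (fun c => c.2 == j) (boxes s) = count (ltn j) s.
Proof.
elim: s => // a s IHs.
rewrite boxes_cons count_cat !count_map /= (eq_count (a2 := pred1 j)) //.
rewrite -IHs count_uniq_mem ?iota_uniq // mem_iota add0n /=.
by congr (_ + _); exact: eq_count.
Qed.

(** The arm together with the corner contributes [a - j]; the leg consists of one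
    box for each lower row longer than [j]. *)
Lemma hook_length_row0 a s j :
  j < a -> hook_length (a :: s) (0, j) = a - j + count (ltn j) s.
Proof.
move=> lt_ja; rewrite /hook_length /hook size_filter boxes_cons count_cat.
rewrite !count_map -(count_column s j); congr (_ + _); last first.
  by apply: eq_count => c /=; rewrite andbT.
rewrite (eq_count (a2 := leq j)); last by move=> k /=; lia.
rewrite -{1}(subnKC (ltnW lt_ja)) iotaD count_cat add0n.
rewrite (eq_in_count (a2 := pred0)) ?count_pred0; last first.
  by move=> k; rewrite mem_iota /=; lia.
rewrite (eq_in_count (a2 := predT)) ?count_predT ?size_iota //.
by move=> k; rewrite mem_iota /=; lia.
Qed.

Lemma hook_lengths_cons a s :
  hook_lengths (a :: s) =
  [seq a - j + count (ltn j) s | j <- iota 0 a] ++ hook_lengths s.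
Proof.
rewrite {1}/hook_lengths boxes_cons map_cat -!map_comp; congr (_ ++ _).
  by apply/eq_in_map => j; rewrite mem_iota /= => /hook_length_row0->.
by apply: eq_map => b /=; rewrite hook_length_row_succ.
Qed.

(** Bead sets naturally encode sequences that may end in rows of length zero; such
    rows have no boxes and occur in no hook. *)
Lemma hook_lengths_rcons0 s : hook_lengths (rcons s 0) = hook_lengths s.
Proof.
elim: s => [|a s IHs] //; rewrite rcons_cons !hook_lengths_cons IHs.
congr (_ ++ _); apply: eq_map => j.
by rewrite -cats1 count_cat /= !addn0.
Qed.

(** * Hook lengths as differences between beads and gaps *)

(** The first-column hook lengths of [la], when all rows are nonempty. *)
Fixpoint beads_of (la : seq nat) : seq nat :=
  if la is a :: s then a + size s :: beads_of s else [::].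

Definition gaps_below (X : seq nat) (x : nat) : seq nat :=
  [seq y <- iota 0 x | y \notin X].

Definition bead_hooks (X : seq nat) : seq nat :=
  [seq x - y | x <- X, y <- gaps_below X x].

Lemma size_beads_of s : size (beads_of s) = size s.
Proof. by elim: s => //= a s ->. Qed.

Lemma sorted_beads_of s : sorted geq s -> sorted gtn (beads_of s).
Proof.
elim: s => //= a [|b s] IHs //= /andP[le_ba] sorted_s.
by have /= -> := IHs sorted_s; rewrite andbT; lia.
Qed.

Lemma gtn_trans : transitive gtn.
Proof. by move=> y x z /= ? ?; lia. Qed.

Lemma sorted_gtn_uniq X : sorted gtn X -> uniq X.
Proof.
by rewrite gtn_sorted_uniq_geq => /andP[].
Qed.

Lemma size_gaps_below X x :
  uniq X -> all (gtn x) X -> size (gaps_below X x) + size X = x.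
Proof.
move=> uniqX /allP ltXx; rewrite size_filter -[RHS](size_iota 0 x).
rewrite -[RHS](count_predC (mem X)) addnC; congr (_ + _).
rewrite -size_filter; apply/perm_size/uniq_perm; rewrite ?filter_uniq ?iota_uniq // => y.
rewrite mem_filter mem_iota /= add0n; case: (boolP (y \in X)) => //= /ltXx.
by rewrite /= => ->.
Qed.

(** The gap attached to column [j] is [j + count (geq j) s], the number of columns
    before [j] plus the number of rows that end at column [j] or before.  It lies strictly
    between the beads of the rows longer than [j] and those of the other rows. *)
Lemma gap_notin_beads_of s j :
  sorted geq s -> j + count (geq j) s \notin beads_of s.
Proof.
elim: s => //= b s IHs sorted_bs; have sorted_s := path_sorted sorted_bs.
rewrite inE negb_or -(count_geq_ltn j s).
case: leqP => [le_bj | lt_jb]; last by rewrite add0n IHs // andbT; lia.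
have sorted_bX := sorted_beads_of (s := b :: s) sorted_bs.
have /allP ltXb := order_path_min gtn_trans sorted_bX.
have /eqP count_gt : count (ltn j) s == 0.
  rewrite -leqn0 leqNgt -has_count; apply/hasPn => c s_c.
  have /allP/(_ c s_c) /= : all (geq b) s.
    by apply: order_path_min sorted_bs => ? ? ? /=; lia.
  lia.
rewrite count_gt; apply/andP; split; first lia.
by apply/negP => /ltXb /=; rewrite -(count_geq_ltn j s); lia.
Qed.

(** The gaps attached to the columns [j < a] are distinct, and there are exactly
    [a] gaps below the bead of the first row, because the [size s] other beads all
    lie below it. *)
Lemma perm_gaps_below a s :
  sorted geq (a :: s) ->
  perm_eq [seq j + count (geq j) s | j <- iota 0 a]
          (gaps_below (beads_of s) (a + size s)).
Proof.
move=> sorted_as; have sorted_s := path_sorted sorted_as.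
have sorted_X := sorted_beads_of sorted_as.
have ltX := order_path_min gtn_trans sorted_X.
have lt_gap i j : i < j -> i + count (geq i) s < j + count (geq j) s.
  move=> lt_ij; suff: count (geq i) s <= count (geq j) s by lia.
  by apply: sub_count => k /=; lia.
have uniq_gap : uniq [seq j + count (geq j) s | j <- iota 0 a].
  rewrite map_inj_uniq ?iota_uniq // => i j eq_ij.
  by case: (ltngtP i j) => // /lt_gap; lia.
have sub_gap : {subset [seq j + count (geq j) s | j <- iota 0 a]
                 <= gaps_below (beads_of s) (a + size s)}.
  move=> y /mapP[j]; rewrite mem_iota add0n => lt_ja ->.
  rewrite mem_filter gap_notin_beads_of // mem_iota add0n /=.
  by have := count_size (geq j) s; lia.
have size_gap := size_gaps_below (sorted_gtn_uniq (path_sorted sorted_X)) ltX.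
have [|_ eq_gap] := uniq_min_size uniq_gap sub_gap.
  move: size_gap; rewrite size_map size_iota size_beads_of => /eqP.
  by rewrite eqn_add2r => /eqP->.
by apply: uniq_perm => //; rewrite filter_uniq ?iota_uniq.
Qed.

Lemma bead_hooks_cons x X :
  all (gtn x) X ->
  bead_hooks (x :: X) = [seq x - y | y <- gaps_below X x] ++ bead_hooks X.
Proof.
move=> /allP ltXx.
have gaps_cons z : z <= x -> gaps_below (x :: X) z = gaps_below X z.
  move=> le_zx; apply/eq_in_filter => y; rewrite mem_iota inE.
  by case: eqP => [->|]; [lia | case: (_ \in _)].
rewrite /bead_hooks /= gaps_cons //; congr (_ ++ flatten _).
by apply/eq_in_map => z Xz; rewrite gaps_cons //; apply/ltnW/ltXx.
Qed.

(** For the first row, with bead [x = a + size s], the hook length in column [j]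
    equals [x] minus the gap attached to [j]; the other rows follow by
    induction. *)
Lemma perm_hook_lengths s :
  sorted geq s -> perm_eq (hook_lengths s) (bead_hooks (beads_of s)).
Proof.
elim: s => // a s IHs sorted_as; have sorted_s := path_sorted sorted_as.
have ltX := order_path_min gtn_trans (sorted_beads_of sorted_as).
rewrite hook_lengths_cons [beads_of _]/= bead_hooks_cons //.
apply: perm_cat (IHs sorted_s).
have /(perm_map (subn (a + size s))) := perm_gaps_below sorted_as.
apply: perm_trans; rewrite -map_comp; apply/permP => P; congr (count P _).
by apply/eq_in_map => j; rewrite mem_iota /= -(count_geq_ltn j s); lia.
Qed.

Lemma perm_bead_hooks X Y :
  perm_eq X Y -> perm_eq (bead_hooks X) (bead_hooks Y).
Proof.
move=> eqXY; have eq_gaps x : gaps_below X x = gaps_below Y x.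
  by apply: eq_filter => y; rewrite (perm_mem eqXY).
rewrite /bead_hooks -(eq_map (fun x => congr1 (map (subn x)) (eq_gaps x))).
exact/perm_flatten/perm_map.
Qed.

(** The inverse of [beads_of]; rows of length zero can occur, namely for the beads
    [k - 1], ..., [1], [0] when [X] contains all numbers below some [k], in decreasing order. *)
Fixpoint rows_of (X : seq nat) : seq nat :=
  if X is x :: Y then x - size Y :: rows_of Y else [::].

Lemma rows_ofK X :
  sorted gtn X -> sorted geq (rows_of X) /\ beads_of (rows_of X) = X.
Proof.
elim: X => //= x X IHX sorted_xX.
have [sorted_rows rowsK] := IHX (path_sorted sorted_xX).
have ltX := order_path_min gtn_trans sorted_xX.
have := size_gaps_below (sorted_gtn_uniq (path_sorted sorted_xX)) ltX.
move=> size_gap; rewrite -(size_beads_of (rows_of X)) rowsK subnK;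
  last by rewrite -[leqRHS]size_gap leq_addl.
split=> //; case: X sorted_xX sorted_rows size_gap {IHX rowsK ltX} => //=.
move=> y X /andP[lt_yx _] -> _; rewrite andbT; lia.
Qed.

Lemma partition_of_rows s :
  sorted geq s ->
  exists2 la, is_partition la & hook_lengths la = hook_lengths s.
Proof.
elim/last_ind: s => [|s a IHs] sorted_sa; first by exists [::].
have [a0 | a_gt0] := posnP a.
  have [|la part_la eq_la] := IHs.
    by move: sorted_sa; rewrite -cats1 => /cat_sorted2[].
  by exists la; rewrite // a0 hook_lengths_rcons0.
exists (rcons s a) => //; rewrite /is_partition sorted_sa /= mem_rcons inE.
rewrite negb_or neq_ltn a_gt0 /=; apply/negP => s0.
move: sorted_sa; rewrite -rev_sorted rev_rcons /= => /(order_path_min _).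
move=> /(_ (fun y x z (le_xy : x <= y) le_yz => leq_trans le_xy le_yz)).
by move=> /allP/(_ 0); rewrite mem_rev s0 => /(_ isT) /=; lia.
Qed.

Lemma partition_of_beads X :
  uniq X ->
  exists2 la, is_partition la & perm_eq (hook_lengths la) (bead_hooks X).
Proof.
move=> uniqX; have sortedX : sorted gtn (sort geq X).
  by rewrite gtn_sorted_uniq_geq sort_uniq uniqX sort_sorted // => x y; lia.
have [sorted_rows rowsK] := rows_ofK sortedX.
have [la part_la eq_la] := partition_of_rows sorted_rows.
exists la => //; rewrite eq_la (perm_trans (perm_hook_lengths sorted_rows)) //.
by rewrite rowsK perm_bead_hooks // perm_sort.
Qed.

(** * The quotient partitions modulo [m] *)

(** The numbers below [x] congruent to [x] modulo [m] are those of the form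
    [q * m + x %% m] with [q < x %/ m]. *)
Lemma count_congruent_below P x m :
  0 < m ->
  count (fun y => (m %| x - y) && P y) (iota 0 x) =
  count (fun q => P (q * m + x %% m)) (iota 0 (x %/ m)).
Proof.
move=> m_gt0; rewrite -count_map -(eq_count (fun _ => andbC _ _)) -count_filter.
apply/permP/uniq_perm.
- by rewrite filter_uniq ?iota_uniq.
- rewrite map_inj_uniq ?iota_uniq // => q1 q2 /addIn/eqP.
  by rewrite eqn_pmul2r // => /eqP.
move=> y; rewrite mem_filter mem_iota add0n /=; apply/andP/mapP.
  case=> m_dvd lt_yx; exists (y %/ m).
    rewrite mem_iota add0n -(ltn_pmul2r m_gt0) -(ltn_add2r (x %% m)).
    move: m_dvd; rewrite -eqn_mod_dvd ?(ltnW lt_yx) // => /eqP {1}->.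
    by rewrite -!divn_eq.
  move: m_dvd; rewrite -eqn_mod_dvd ?(ltnW lt_yx) // => /eqP->.
  exact: divn_eq.
case=> q; rewrite mem_iota add0n /= => lt_q ->.
have lt_qx : q * m + x %% m < x.
  by rewrite [ltnRHS](divn_eq x m) ltn_add2r ltn_pmul2r.
by rewrite -eqn_mod_dvd ?(ltnW lt_qx) // modnMDl modn_mod.
Qed.

Definition runner (m i : nat) (X : seq nat) : seq nat :=
  [seq x %/ m | x <- X & x %% m == i].

Lemma count_bead_hooks P X :
  count P (bead_hooks X) =
  \sum_(x <- X) count (fun y => (y \notin X) && P (x - y)) (iota 0 x).
Proof.
rewrite /bead_hooks count_flatten sumnE !big_map; apply: eq_bigr => x _.
by rewrite count_map count_filter; apply: eq_count => y; rewrite /= andbC.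
Qed.

Lemma mem_runner m i X q :
  i < m -> (q \in runner m i X) = (q * m + i \in X).
Proof.
move=> lt_im; have m_gt0 := leq_ltn_trans (leq0n i) lt_im.
apply/mapP/idP => [[x]|Xq]; last first.
  exists (q * m + i); last by rewrite divnMDl // divn_small // addn0.
  by rewrite mem_filter Xq modnMDl modn_small // eqxx.
by rewrite mem_filter => /andP[/eqP <- Xx] ->; rewrite -divn_eq.
Qed.

Lemma runner_uniq m i X : uniq X -> uniq (runner m i X).
Proof.
move=> uniqX; rewrite map_inj_in_uniq ?filter_uniq // => x y.
rewrite !mem_filter => /andP[/eqP x_i _] /andP[/eqP y_i _] eq_div.
by rewrite (divn_eq x m) (divn_eq y m) eq_div x_i y_i.
Qed.

(** A bead and a gap differ by a multiple of [m] exactly when they have the same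
    residue, and then the difference divided by [m] is the one seen on the runner of
    that residue. *)
Lemma perm_bead_hooks_runners m X :
  0 < m ->
  perm_eq [seq h %/ m | h <- bead_hooks X & m %| h]
          (flatten [seq bead_hooks (runner m i X) | i <- iota 0 m]).
Proof.
move=> m_gt0; apply/permP => P.
rewrite count_map count_filter count_bead_hooks count_flatten sumnE !big_map.
under [RHS]eq_bigr => i _ do rewrite count_bead_hooks big_map big_filter.
rewrite (exchange_big_dep xpredT) //=; apply: eq_bigr => x _.
under eq_bigl => i do rewrite eq_sym.
have -> : iota 0 m = index_iota 0 m by rewrite /index_iota subn0.
rewrite big_nat1_eq ltn_mod m_gt0 /=.
transitivity (count (fun y => (m %| x - y)
                              && ((y \notin X) && P ((x - y) %/ m))) (iota 0 x)).
  by apply: eq_count => y /=; rewrite [RHS]andbC -andbA.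
rewrite count_congruent_below //; apply: eq_count => q.
rewrite mem_runner ?ltn_mod //; congr (_ && P _).
by rewrite {1}(divn_eq x m) subnDr -mulnBl mulnK.
Qed.

(** The family [mu] is the [m]-quotient of [la].  Its order depends on the number of
    beads, but only the multiset of all hook lengths matters here. *)
Lemma hook_quotient_partitions m la :
  0 < m -> is_partition la ->
  exists2 mu : nat -> seq nat, forall i, is_partition (mu i) &
    perm_eq (hook_quotients m la) (flatten [seq hook_lengths (mu i) | i <- iota 0 m]).
Proof.
move=> m_gt0 /andP[sorted_la _].
have uniqX := sorted_gtn_uniq (sorted_beads_of sorted_la).
set X := beads_of la in uniqX.
have exists_mu i := sig2W (partition_of_beads (runner_uniq m i uniqX)).
exists (fun i => s2val (exists_mu i)) => [i|]; first exact: s2valP (exists_mu i).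
have := perm_hook_lengths sorted_la.
move=> /(perm_filter (dvdn m))/(perm_map (divn^~ m))/perm_trans; apply.
apply: (perm_trans (perm_bead_hooks_runners X m_gt0)).
elim: (iota 0 m) => //= i s IHs; apply: perm_cat IHs.
by rewrite perm_sym; exact: s2valP' (exists_mu i).
Qed.

Lemma runner_scale0 m Y : 0 < m -> runner m 0 [seq m * y | y <- Y] = Y.
Proof.
move=> m_gt0; rewrite /runner filter_map (eq_filter (a2 := predT)).
  by rewrite filter_predT -map_comp map_id_in // => y _ /=; rewrite mulKn.
by move=> y /=; rewrite modnMr.
Qed.

Lemma runner_scale_neq0 m i Y : 0 < i -> runner m i [seq m * y | y <- Y] = [::].
Proof.
move=> i_gt0; rewrite /runner filter_map (eq_filter (a2 := pred0)).
  by rewrite filter_pred0.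
by move=> y /=; rewrite modnMr; lia.
Qed.

(** Multiplying all beads by [m] puts them on the runner of residue 0 and leaves the
    other runners empty: this gives a partition with [m]-quotient
    [(mu, 0, ..., 0)]. *)
Lemma partition_scaling_hooks m mu :
  0 < m -> is_partition mu ->
  exists2 la, is_partition la & perm_eq (hook_quotients m la) (hook_lengths mu).
Proof.
move=> m_gt0 /andP[sorted_mu _]; set Y := beads_of mu.
have uniqY : uniq Y := sorted_gtn_uniq (sorted_beads_of sorted_mu).
pose X := [seq m * y | y <- Y].
have injm : injective (muln m).
  by move=> x y /eqP; rewrite eqn_pmul2l // => /eqP.
have [la part_la hooks_la] : exists2 la, is_partition la &
    perm_eq (hook_lengths la) (bead_hooks X).
  by apply: partition_of_beads; rewrite map_inj_uniq.
exists la => //.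
move: hooks_la => /(perm_filter (dvdn m))/(perm_map (divn^~ m))/perm_trans; apply.
apply: (perm_trans (perm_bead_hooks_runners X m_gt0)).
rewrite perm_sym; apply: (perm_trans (perm_hook_lengths sorted_mu)).
rewrite /X -[in iota 0 m](prednK m_gt0) /= runner_scale0 // -[X in perm_eq X]cats0.
rewrite perm_cat2l [X in perm_eq _ X](_ : _ = [::]) //.
apply/nilP; rewrite /nilp size_flatten sumnE.
rewrite !big_map big_seq big1 // => i; rewrite mem_iota => /andP[i_gt0 _].
by rewrite runner_scale_neq0.
Qed.

(** * Prime factorization of products of hook quotients *)
Lemma mem_hook_lengths_gt0 la h : h \in hook_lengths la -> 0 < h.
Proof.
elim: la => // a la IHla; rewrite hook_lengths_cons mem_cat.
by case/orP=> [/mapP[j]|/IHla //]; rewrite mem_iota => lt_ja ->; lia.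
Qed.

Lemma mem_hook_lengths_le la h : h \in hook_lengths la -> h <= size (boxes la).
Proof. by case/mapP=> b _ ->; rewrite /hook_length size_filter count_size. Qed.

Lemma mem_hook_quotients r la h :
  h \in hook_quotients r la -> 0 < h <= size (boxes la).
Proof.
case/mapP=> h'; rewrite mem_filter => /andP[r_dvd h'_la] ->.
have h'_gt0 := mem_hook_lengths_gt0 h'_la.
rewrite divn_gt0 ?(dvdn_gt0 h'_gt0) // dvdn_leq //=.
exact: leq_trans (leq_div _ _) (mem_hook_lengths_le h'_la).
Qed.

Lemma hook_countE r la : hook_count r la = count (dvdn r) (hook_lengths la).
Proof. by rewrite /hook_count size_map size_filter. Qed.

Lemma hook_countM r m la :
  0 < r -> hook_count (r * m) la = count (dvdn m) (hook_quotients r la).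
Proof.
move=> r_gt0; rewrite hook_countE [RHS]count_map count_filter; apply: eq_count => h /=.
apply/idP/andP=> [rm_dvd | [m_dvd r_dvd]].
  have r_dvd := dvdn_trans (dvdn_mulr m (dvdnn r)) rm_dvd.
  by rewrite dvdn_divRL // mulnC.
by rewrite mulnC -dvdn_divRL.
Qed.

Lemma hook_prod_gt0 r la : 0 < hook_prod r la.
Proof.
rewrite /hook_prod big_seq prodn_cond_gt0 // => h.
by case/mem_hook_quotients/andP.
Qed.

(** The bound [N] is uniform in [n], so that the sums for all the hooks of a diagram
    can be exchanged with the sum over [k]. *)
Lemma logn_count_dvd_below p n N :
  prime p -> 0 < n <= N -> logn p n = \sum_(1 <= k < N) (p ^ k %| n).
Proof.
move=> p_pr /andP[n_gt0 le_nN]; rewrite logn_count_dvd //.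
rewrite (@big_cat_nat _ _ _ n 1 N) //= [X in _ = _ + X]big_nat.
rewrite [X in _ + X]big1 ?addn0 // => k /andP[le_nk _].
apply/eqP; rewrite eqb0; apply/negP => /(dvdn_leq n_gt0).
by have := ltn_expl k (prime_gt1 p_pr); lia.
Qed.

Lemma logn_prod_seq p (s : seq nat) :
  {in s, forall h, 0 < h} -> logn p (\prod_(h <- s) h) = \sum_(h <- s) logn p h.
Proof.
elim: s => [|h s IHs] s_gt0; first by rewrite !big_nil logn1.
have s'_gt0 : {in s, forall h, 0 < h}.
  by move=> k s_k; apply: s_gt0; rewrite inE s_k orbT.
have prod_gt0 : 0 < \prod_(k <- s) k by rewrite big_seq prodn_cond_gt0.
by rewrite !big_cons lognM ?IHs ?(s_gt0 h) ?mem_head.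
Qed.

(** Exchange of sums: the exponent [k] counts once for every hook quotient
    divisible by [p ^ k], that is for every hook length divisible by
    [r * p ^ k]. *)
Lemma logn_hook_prod p r la N :
  prime p -> 0 < r -> size (boxes la) <= N ->
  logn p (hook_prod r la) = \sum_(1 <= k < N) hook_count (r * p ^ k) la.
Proof.
move=> p_pr r_gt0 le_N; rewrite logn_prod_seq; last first.
  by move=> h /mem_hook_quotients/andP[].
rewrite [LHS](eq_big_seq (fun h => \sum_(1 <= k < N) (p ^ k %| h))) /=; last first.
  move=> h /mem_hook_quotients/andP[h_gt0 le_h].
  by apply: logn_count_dvd_below; rewrite // h_gt0 (leq_trans le_h).
rewrite exchange_big; apply: eq_bigr => k _.
by rewrite hook_countM // -sumn_count sumnE big_map.
Qed.

Lemma dvdn_lognP m n :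
  0 < m -> 0 < n ->
  reflect (forall p, prime p -> logn p m <= logn p n) (m %| n).
Proof.
move=> m_gt0 n_gt0; apply: (iffP idP) => [m_dvd p _ | le_log].
  exact: dvdn_leq_log.
apply/dvdn_partP=> // p; rewrite mem_primes => /andP[p_pr _].
by rewrite p_part pfactor_dvdn // le_log.
Qed.

(** * Divisibility of products and comparison of counts *)

(** One family [mu] serves all [g] at once, which makes it possible to compare the
    sums over several values of [g]. *)
Lemma hook_quotient_counts m la :
  0 < m -> is_partition la ->
  exists2 mu : nat -> seq nat, forall i, is_partition (mu i) &
    forall g, hook_count (g * m) la = \sum_(i <- iota 0 m) hook_count g (mu i).
Proof.
move=> m_gt0 part_la.
have [mu part_mu /permP eq_mu] := hook_quotient_partitions m_gt0 part_la.
exists mu => // g; rewrite mulnC hook_countM // eq_mu count_flatten sumnE !big_map.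
by apply: eq_bigr => i _; rewrite hook_countE.
Qed.

Lemma logn_prod_hook_prod (T : finType) (g : T -> nat) p la N :
  (forall t, 0 < g t) -> prime p -> size (boxes la) <= N ->
  logn p (\prod_t hook_prod (g t) la) =
  \sum_(1 <= k < N) \sum_t hook_count (g t * p ^ k) la.
Proof.
move=> g_gt0 p_pr le_N; rewrite -(big_map (fun t => hook_prod (g t) la) predT id).
rewrite logn_prod_seq ?big_map; last by move=> h /mapP[t _ ->]; exact: hook_prod_gt0.
by rewrite exchange_big; apply: eq_bigr => t _; exact: logn_hook_prod.
Qed.

(** Both directions read off the exponent of a prime.  From divisibility to counts,
    a large prime isolates the term [k = 1]; from counts to divisibility, each term
    [k] is a sum of counts over the [p ^ k]-quotient. *)
Lemma dvdn_hook_prodP (I J : finType) (gamma : I -> nat) (delta : J -> nat) :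
  (forall i, 0 < gamma i) -> (forall j, 0 < delta j) ->
  (forall la, is_partition la ->
     \prod_j hook_prod (delta j) la %| \prod_i hook_prod (gamma i) la) <->
  (forall mu, is_partition mu ->
     \sum_j hook_count (delta j) mu <= \sum_i hook_count (gamma i) mu).
Proof.
move=> gamma_gt0 delta_gt0.
have prod_gt0 (T : finType) (g : T -> nat) la : 0 < \prod_t hook_prod (g t) la.
  by apply: prodn_gt0 => t; exact: hook_prod_gt0.
split=> [dvd_la mu part_mu | le_count la part_la].
  have [p lt_p p_pr] := prime_above (size (boxes mu)).
  have [la part_la /permP eq_la] := partition_scaling_hooks (prime_gt0 p_pr) part_mu.
  have logn_la (T : finType) (g : T -> nat) : (forall t, 0 < g t) ->
      logn p (\prod_t hook_prod (g t) la) = \sum_t hook_count (g t) mu.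
    have le_N : size (boxes la) <= (size (boxes la)).+2 by rewrite leqW ?leqnSn.
    move=> g_gt0; rewrite (logn_prod_hook_prod g_gt0 p_pr le_N).
    rewrite big_ltn // expn1 [X in _ + X]big_nat [X in _ + X]big1 ?addn0.
      apply: eq_bigr => t _.
      by rewrite mulnC hook_countM ?prime_gt0 // eq_la hook_countE.
    (* For k > 1, g t * p ^ (k - 1) >= p exceeds every hook length of mu. *)
    move=> k /andP[k_gt1 _]; apply: big1 => t _.
    rewrite -(prednK (ltnW k_gt1)) expnS mulnCA hook_countM ?prime_gt0 // eq_la.
    apply/eqP; rewrite -leqn0 leqNgt -has_count; apply/hasPn => h mu_h.
    have h_gt0 := mem_hook_lengths_gt0 mu_h.
    apply/negP => /(dvdn_leq h_gt0); apply/negP; rewrite -ltnNge.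
    apply: leq_ltn_trans (mem_hook_lengths_le mu_h) (leq_trans lt_p _).
    have [j ->] : exists j, k.-1 = j.+1 by exists k.-2; lia.
    by rewrite expnS mulnCA leq_pmulr // muln_gt0 g_gt0 expn_gt0 prime_gt0.
  by rewrite -!logn_la //; exact: dvdn_leq_log (prod_gt0 _ _ _) (dvd_la _ part_la).
apply/dvdn_lognP => // p p_pr.
rewrite !(@logn_prod_hook_prod _ _ p la (size (boxes la))) //.
apply: leq_sum => k _.
have pk_gt0 : 0 < p ^ k by rewrite expn_gt0 prime_gt0.
have [mu part_mu count_mu] := hook_quotient_counts pk_gt0 part_la.
under eq_bigr do rewrite count_mu.
under [leqRHS]eq_bigr do rewrite count_mu.
rewrite exchange_big [leqRHS]exchange_big; apply: leq_sum => i _.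
exact: le_count.
Qed.

Lemma Qint_ratio_nat (m n : nat) :
  0 < n -> ((m%:R / n%:R : rat)%R \is a Num.int) = (n %| m).
Proof.
move=> n_gt0; have nz_n : (n%:R : rat)%R != 0%R by rewrite pnatr_eq0 -lt0n.
rewrite intrEge0 ?divr_ge0 ?ler0n //.
apply/natrP/dvdnP => [[q def_q] | [q ->]]; exists q; last by rewrite natrM mulfK.
by apply/eqP; rewrite -(eqr_nat rat) natrM -def_q divfK.
Qed.

Local Open Scope ring_scope.

Theorem theorem2 (K L : nat) (gamma : 'I_K -> nat) (delta : 'I_L -> nat)
  (gamma_gt0 : forall k : 'I_K, (0 < gamma k)%N)
  (delta_gt0 : forall l : 'I_L, (0 < delta l)%N) :
  (forall la : seq nat, is_partition la ->
     (\prod_(k < K) (hook_prod (gamma k) la)%:R) /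
     (\prod_(l < L) (hook_prod (delta l) la)%:R) \is a @Num.int rat)
  <->
  (forall mu : seq nat, is_partition mu ->
     0 <= \sum_(k < K) (hook_count (gamma k) mu)%:Z
          - \sum_(l < L) (hook_count (delta l) mu)%:Z).
Proof.
have ratioE la :
  (\prod_(k < K) (hook_prod (gamma k) la)%:R) /
  (\prod_(l < L) (hook_prod (delta l) la)%:R) \is a @Num.int rat =
  (\prod_(l < L) hook_prod (delta l) la %| \prod_(k < K) hook_prod (gamma k) la)%N.
  by rewrite -!natr_prod Qint_ratio_nat // prodn_gt0 // => l; exact: hook_prod_gt0.
have countE mu :
  (0 <= \sum_(k < K) (hook_count (gamma k) mu)%:Z
        - \sum_(l < L) (hook_count (delta l) mu)%:Z) =
  (\sum_(l < L) hook_count (delta l) mu <= \sum_(k < K) hook_count (gamma k) mu)%N.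
  by rewrite subr_ge0 -!(big_morph Posz PoszD erefl) lez_nat.
have [dvd_count count_dvd] := dvdn_hook_prodP gamma_gt0 delta_gt0.
split=> [int_la mu part_mu | ge0_mu la part_la].
  by rewrite countE; apply: dvd_count part_mu => la /int_la; rewrite ratioE.
by rewrite ratioE; apply: count_dvd part_la => mu /ge0_mu; rewrite countE.
Qed.
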